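(* A signed weak morphism of signed digraphs $(f,\eta):(D,\sigma)\to(D',\sigma')$ induces a chain map \[ (f,\eta)_\#:\Omega_\bullet^\sigma(D)\longrightarrow\Omega_\bullet^{\sigma'}(D'),\qquad \partial_*^{\sigma'}(f,\eta)_\#=(f,\eta)_\#\partial_*^\sigma, \] and therefore linear maps \[ (f,\eta)_*:H_p^\sigma(D)\longrightarrow H_p^{\sigma'}(D') \] for all $p\ge0$. The induced map $(f,\eta)_*$ sends the homology class $[z]$ to $[(f,\eta)_\#z]$, and for composable signed weak morphisms $(f,\eta)$ and $(g,\theta)$ the induced maps satisfy \[ (\mathrm{id}_D,\mathbf 1)_*=\mathrm{id},\qquad \bigl((g,\theta)\circ(f,\eta)\bigr)_*=(g,\theta)_*\circ(f,\eta)_*. \] Thus $(D,\sigma)\mapsto H_p^\sigma(D)$ is a functor from signed digraphs with signed weak morphisms to real vector spaces.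
   Context: Signed digraphs. A signed digraph is a pair $(D,\sigma)$ where $D=(V(D),A(D))$ is a finite loopless digraph with at most one arrow from $i$ to $j$ for each ordered pair $(i,j)$, and $\sigma:A(D)\to\{+1,-1\}$ is any function (antiparallel arrows are allowed and may have different signs). The signed double cover $\widetilde D_\sigma$ is the digraph with vertices $i^\varepsilon=(i,\varepsilon)\in V(D)\times\{+1,-1\}$ and arrows $i^\varepsilon\to j^{\varepsilon\sigma(ij)}$ for each arrow $i\to j$ of $D$ and each $\varepsilon$; the deck involution is $\tau(i^\varepsilon)=i^{-\varepsilon}$, acting on paths vertexwise. Signed GLMY homology (over $\mathbb R$). A $p$-path on $V(D)\times\{+1,-1\}$ is a sequence of $p+1$ lifted vertices; it is regular if consecutive lifted vertices are distinct (so $u^+u^-$ is regular, $u^+u^+$ is not) and allowed if consecutive lifted vertices are joined by arrows of $\widetilde D_\sigma$. $\mathcal R_p(\widetilde D_\sigma)$ is the real vector space with basis $e_{\widetilde\gamma}$, $\widetilde\gamma$ a regular $p$-path (no arrow condition), with boundary $e_{v_0\cdots v_p}\mapsto\sum_{q=0}^p(-1)^qe_{v_0\cdots\widehat{v_q}\cdots v_p}$ for $p\ge1$ (nonregular terms are zero), and zero boundary for $p=0$. $R_p^\sigma(D)$ is the quotient of $\mathcal R_p(\widetilde D_\sigma)$ by the span of all $e_{\tau\widetilde\gamma}+e_{\widetilde\gamma}$; $[e_{\widetilde\gamma}]$ is the class of $e_{\widetilde\gamma}$. The boundary induces $\partial^\sigma_{\mathrm{reg},p}:R_p^\sigma(D)\to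 R_{p-1}^\sigma(D)$ (zero for $p=0$). $\mathcal A_p^\sigma(D)\subseteq R_p^\sigma(D)$ is the span of the classes of allowed paths. Set $\Omega_0^\sigma(D)=\mathcal A_0^\sigma(D)$, $\Omega_p^\sigma(D)=\{z\in\mathcal A_p^\sigma(D):\partial^\sigma_{\mathrm{reg},p}z\in\mathcal A^\sigma_{p-1}(D)\}$ for $p\ge1$, $\Omega_{-1}^\sigma(D)=0$, with boundary $\partial_p^\sigma:\Omega_p^\sigma(D)\to\Omega_{p-1}^\sigma(D)$ the restriction of $\partial^\sigma_{\mathrm{reg},p}$. $H_p^\sigma(D)$ is the homology of $(\Omega_\bullet^\sigma(D),\partial_*^\sigma)$. Signed weak morphisms. A signed weak morphism $(f,\eta):(D,\sigma)\to(D',\sigma')$ consists of a vertex map $f:V(D)\to V(D')$ and a function $\eta:V(D)\to\{+1,-1\}$ such that for every arrow $i\to j$ of $D$: (i) if $f(i)\ne f(j)$, then $f(i)\to f(j)$ is an arrow of $D'$ and $\sigma'(f(i)f(j))=\eta(i)\sigma(ij)\eta(j)$; (ii) if $f(i)=f(j)$, then $\sigma(ij)=\eta(i)\eta(j)$. The function $\eta$ is part of the data. Composition with $(g,\theta):(D',\sigma')\to(D'',\sigma'')$ is $(g,\theta)\circ(f,\eta)=(g\circ f,\zeta)$, $\zeta(i)=\theta(f(i))\eta(i)$; the identity is $(\mathrm{id}_D,\mathbf1)$ with $\mathbf1(v)=+1$ for all $v$. Induced maps. Put $\widetilde f(i^\varepsilon)=f(i)^{\eta(i)\varepsilon}$,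 and let $\widetilde f(\widetilde\gamma)$ be the vertexwise image of a path $\widetilde\gamma$. The linear map $(f,\eta)_\#:R_p^\sigma(D)\to R_p^{\sigma'}(D')$ is defined by $(f,\eta)_\#[e_{\widetilde\gamma}]=[e_{\widetilde f(\widetilde\gamma)}]$ if $\widetilde f(\widetilde\gamma)$ is regular, and $0$ otherwise, for each regular lifted path $\widetilde\gamma$; the chain map in the claim is its restriction to $\Omega_\bullet^\sigma(D)$. *)

(* Defs.v *)
From HB Require Import structures.
From mathcomp Require Import all_boot all_order all_algebra.
From mathcomp Require Import generic_quotient ring_quotient.
From mathcomp Require Import boolp reals zify.

Set Implicit Arguments.
Unset Strict Implicit.
Unset Printing Implicit Defensive.

Import GRing.Theory Num.Theory.
Local Open Scope ring_scope.
Local Open Scope quotient_scope.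

Section QuotientSpace.
Variables (F : fieldType) (vT : vectType F) (U : {vspace vT}).

Definition vquot : Type := Quotient.quot U.

HB.instance Definition _ := GRing.Zmodule.on vquot.

Definition vclass (x : vT) : vquot := \pi_(Quotient.quot U) x.

Definition vrepr (q : vquot) : vT := repr (q : Quotient.quot U).

Lemma vreprK q : vclass (vrepr q) = q.
Proof. exact: reprK. Qed.

Lemma vclass_eq x y : (vclass x = vclass y) <-> (x - y \in U).
Proof. by rewrite (Quotient.idealrBE U); split=> [/eqP|/eqP]. Qed.

Let scale (a : F) (q : vquot) : vquot := vclass (a *: vrepr q).

Let vclass_scale a x : scale a (vclass x) = vclass (a *: x).
Proof.
apply/vclass_eq; rewrite -scalerBr memvZ //.
by apply/vclass_eq; rewrite vreprK.
Qed.

Let vclassD x y : vclass x + vclass y = vclass (x + y).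
Proof. by rewrite /vclass raddfD. Qed.

Let scaleA a b q : scale a (scale b q) = scale (a * b) q.
Proof. by rewrite -[q]vreprK !vclass_scale scalerA. Qed.
Let scale1 : left_id 1 scale.
Proof. by move=> q; rewrite -[q]vreprK vclass_scale scale1r. Qed.
Let scaleDr : right_distributive scale +%R.
Proof.
move=> a q r; rewrite -[q]vreprK -[r]vreprK.
by rewrite !(vclassD, vclass_scale) scalerDr.
Qed.
Let scaleDl q : {morph scale^~ q : a b / a + b}.
Proof.
by move=> a b; rewrite -[q]vreprK !(vclassD, vclass_scale) scalerDl.
Qed.

HB.instance Definition _ :=
  GRing.Zmodule_isLmodule.Build F vquot scaleA scale1 scaleDr scaleDl.

Lemma vclass_is_linear : linear vclass.
Proof.
by move=> a x y; rewrite -vclassD -vclass_scale.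
Qed.
HB.instance Definition _ :=
  GRing.isLinear.Build F vT vquot _ vclass vclass_is_linear.

(* A linear section of vclass, with range a complement of U. *)
Definition vsection (q : vquot) : vT := vrepr q - projv U (vrepr q).

Lemma vsection_class x : vsection (vclass x) = x - projv U x.
Proof.
have /vclass_eq/projv_id : vclass (vrepr (vclass x)) = vclass x.
  by rewrite vreprK.
rewrite linearB => /eqP; rewrite subr_eq => /eqP pE.
by rewrite /vsection pE opprD opprB addrA subrKC.
Qed.

Lemma vsection_is_linear : linear vsection.
Proof.
move=> a q r; rewrite -[q]vreprK -[r]vreprK -linearP !vsection_class.
by rewrite linearP scalerBr addrACA -opprD.
Qed.
HB.instance Definition _ :=
  GRing.isLinear.Build F vquot vT _ vsection vsection_is_linear.

Lemma vsectionK q : vclass (vsection q) = q.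
Proof.
rewrite -[q]vreprK vsection_class; apply/vclass_eq.
by rewrite addrAC subrr add0r memvN memv_proj.
Qed.

Fact vquot_vect_iso : Vector.axiom (\dim (U^C)%VS) vquot.
Proof.
pose b := vbasis (U^C)%VS.
exists (fun q => \row_i coord b i (vsection q)).
  by move=> a q r; apply/rowP=> i; rewrite !mxE !linearP.
exists (fun v : 'rV_(\dim (U^C)%VS) => vclass (\sum_i v 0 i *: b`_i)) => [q | v].
  have qC : vsection q \in (U^C)%VS.
    by rewrite -[q]vreprK vsection_class memv_projC.
  rewrite -[RHS]vsectionK [in RHS](coord_vbasis qC); congr (vclass _).
  by apply: eq_bigr => i _; rewrite mxE.
apply/rowP=> i; rewrite mxE vsection_class.
have : \sum_i v 0 i *: b`_i \in lker (projv U).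
  rewrite lker_proj; apply: rpred_sum => j _.
  by rewrite rpredZ ?vbasis_mem ?memt_nth.
rewrite memv_ker => /eqP->; rewrite subr0.
by rewrite coord_sum_free ?(basis_free (vbasisP _)).
Qed.
HB.instance Definition _ := Lmodule_hasFinDim.Build F vquot vquot_vect_iso.

Section Lift.
Variable wT : vectType F.

(* The map induced on vquot by f. It is total: it is the usual induced map    *)
(* when f vanishes on U (lemma vlift_class).                                  *)
Definition vlift (f : 'Hom(vT, wT)) : 'Hom(vquot, wT) :=
  linfun (f \o vsection).

Lemma vlift_class (f : 'Hom(vT, wT)) :
  (U <= lker f)%VS -> forall x, vlift f (vclass x) = f x.
Proof.
move=> /subvP fU0 x; rewrite lfunE /= vsection_class linearB /=.
have /fU0 : projv U x \in U by rewrite memv_proj.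
by rewrite memv_ker => /eqP->; rewrite subr0.
Qed.
End Lift.
End QuotientSpace.

Section LinearExtension.
Variables (K : fieldType) (I : finType) (wT : vectType K) (phi : I -> wT).

Let lext_fun (x : {ffun I -> K^o}) : wT := \sum_i x i *: phi i.

Let lext_fun_linear : linear lext_fun.
Proof.
move=> a x y; rewrite /lext_fun scaler_sumr -big_split /=.
by apply: eq_bigr => i _; rewrite !ffunE scalerDl scalerA.
Qed.
HB.instance Definition _ :=
  GRing.isLinear.Build K {ffun I -> K^o} wT _ lext_fun lext_fun_linear.

Definition lext : 'Hom({ffun I -> K^o}, wT) := linfun lext_fun.

Lemma lextE x : lext x = \sum_i x i *: phi i.
Proof. by rewrite lfunE. Qed.
End LinearExtension.

Section RegularPaths.
Variables (R : realType) (X : finType).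
Implicit Type p : nat.

Definition regular n (t : n.-tuple X) : bool := sorted (fun x y => x != y) t.

Definition rpath p := {t : p.+1.-tuple X | regular t}.

Definition chain p := {ffun rpath p -> R^o}.

(* The basis vector e_t; by this definition it is 0 when t is not regular. *)
Definition epath p (t : p.+1.-tuple X) : chain p :=
  [ffun g : rpath p => (val g == t)%:R].

Definition face p (t : p.+2.-tuple X) (q : 'I_p.+2) : p.+1.-tuple X :=
  [tuple tnth t (lift q k) | k < p.+1].

Definition bd p : 'Hom(chain p.+1, chain p) :=
  lext (fun g : rpath p.+1 => \sum_(q < p.+2) (-1) ^+ q *: epath (face (val g) q)).

Lemma epath_nonregular p (t : p.+1.-tuple X) : ~~ regular t -> epath t = 0.
Proof.
move=> tN; apply/ffunP=> g; rewrite !ffunE.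
by case: eqP => // gt; case/negP: tN; rewrite -gt (valP g).
Qed.

Lemma lext_epath p (wT : vectType R) (phi : p.+1.-tuple X -> wT) t :
  regular t -> lext (fun g : rpath p => phi (val g)) (epath t) = phi t.
Proof.
move=> tR; rewrite lextE (bigD1 (Sub t tR)) //= ffunE SubK eqxx scale1r.
rewrite big1 ?addr0 // => g; rewrite ffunE -val_eqE SubK => /negPf->.
by rewrite scale0r.
Qed.

Lemma chain_sum p (x : chain p) : x = \sum_g x g *: epath (val g).
Proof.
apply/ffunP=> h; rewrite sum_ffunE (bigD1 h) //= !ffunE eqxx.
rewrite big1 => [|g /negPf gh]; first by rewrite addr0 /GRing.scale /= mulr1.
by rewrite !ffunE val_eqE eq_sym gh scaler0.
Qed.

Lemma nonregularP p (t : p.+2.-tuple X) :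
  reflect (exists k : 'I_p.+1, tnth t (widen_ord (leqnSn _) k) = tnth t (lift ord0 k))
          (~~ regular t).
Proof.
have x0 := thead t; apply: (iffP idP) => [|[k]].
  apply: contraNP => tR; apply/(sortedP x0) => i; rewrite size_tuple ltnS => ip.
  apply/eqP => ti; apply: tR; exists (Ordinal ip).
  by rewrite !(tnth_nth x0).
rewrite !(tnth_nth x0) /= => tk; apply/negP => /(sortedP x0)/(_ k).
by rewrite size_tuple ltnS ltn_ord tk eqxx => /(_ isT).
Qed.

(* This also holds for nonregular t: both sides are then 0. *)
Lemma bd_epath p (t : p.+2.-tuple X) :
  bd p (epath t) = \sum_(q < p.+2) (-1) ^+ q *: epath (face t q).
Proof.
case: (boolP (regular t)) => [tR | tN].
  exact: (lext_epath (fun t => \sum_(q < p.+2) (-1) ^+ q *: epath (face t q))).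
rewrite epath_nonregular // linear0.
have /nonregularP[k tk] := tN.
pose k0 : 'I_p.+2 := widen_ord (leqnSn _) k; pose k1 : 'I_p.+2 := lift ord0 k.
have k01 : k1 != k0 by rewrite -val_eqE /= /bump /= add1n eqn_leq ltnn.
rewrite (bigD1 k0) //= (bigD1 k1) //= big1 => [|q /andP[q0 q1]].
  have -> : face t k1 = face t k0.
    apply: eq_from_tnth => i; rewrite !tnth_mktuple.
    have [ik | ik] := eqVneq i k.
      have -> : lift k1 i = k0.
        by apply: val_inj; rewrite /= /bump /= ik /bump add1n ltnn.
      have -> : lift k0 i = k1.
        by apply: val_inj; rewrite /= /bump /= ik /bump leqnn.
      exact: tk.
    congr (tnth t _); apply: val_inj; rewrite /= /bump /= add1n ltn_neqAle.
    by rewrite eq_sym val_eqE ik.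
  rewrite addr0 -scalerDl /= /bump /= add1n exprS mulN1r subrr.
  by rewrite scale0r.
rewrite epath_nonregular ?scaler0 //.
have [j0 qj0 _] := unlift_some q0; have [j1 qj1 _] := unlift_some q1.
have j10 : j1 = j0.+1 :> nat.
  move: (congr1 val qj0) (congr1 val qj1); rewrite /= /bump.
  by do 2!case: leqP => ?; lia.
apply/negP => /(sortedP (thead t))/(_ j0).
rewrite size_tuple -j10 ltn_ord -!tnth_nth !tnth_mktuple -qj0 -qj1.
by rewrite tk eqxx => /(_ isT).
Qed.

Lemma bd_bd p : (bd p \o bd p.+1)%VF = 0.
Proof.
apply/lfunP=> x; rewrite zero_lfunE comp_lfunE [x]chain_sum !linear_sum /=.
apply: big1 => g _; rewrite !linearZ /= bd_epath; move: (x g) (val g) => a t.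
rewrite linear_sum /= (eq_bigr (fun q : 'I_p.+3 => \sum_(r < p.+2)
  (-1) ^+ (q + r) *: epath (face (face t q) r))); last first.
  move=> q _; rewrite linearZ /= bd_epath scaler_sumr.
  by apply: eq_bigr => r _; rewrite scalerA exprD.
rewrite pair_bigA /=; set S := (X in a *: X).
suff SN : S = - S.
  suff -> : S = 0 by rewrite scaler0.
  apply/eqP; have /eqP := SN; rewrite -addr_eq0 -mulr2n -scaler_nat.
  by rewrite scaler_eq0 pnatr_eq0.
pose h (u : 'I_p.+3 * 'I_p.+2) : 'I_p.+3 * 'I_p.+2 :=
  (lift u.1 u.2, inord (unbump u.2 u.1)).
have hE u : val (h u).2 = unbump u.2 u.1.
  rewrite /h /= inordK // /unbump.
  by move: (ltn_ord u.1) (ltn_ord u.2); case: ltnP; lia.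
have h1E u : val (h u).1 = bump u.1 u.2 by [].
have hK : involutive h.
  move=> u; rewrite [h _]surjective_pairing [RHS]surjective_pairing.
  congr (_, _); apply: val_inj; rewrite ?h1E ?hE ?h1E ?hE /unbump /bump.
    by do !case: leqP => ? /=; lia.
  by do !case: leqP => ? /=; lia.
rewrite {1}/S (reindex_inj (inv_inj hK)) -sumrN; apply: eq_bigr => u _.
have -> : face (face t (h u).1) (h u).2 = face (face t u.1) u.2.
  apply: eq_from_tnth => i; rewrite !tnth_mktuple; congr (tnth t _).
  by apply: val_inj; rewrite /= hE -bumpC.
rewrite -scaleNr; congr (_ *: _).
rewrite hE -signr_odd -[in RHS]signr_odd -signrN; congr (_ ^+ _).
rewrite /= /unbump /bump; do !case: leqP => ? /=; lia.
Qed.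

End RegularPaths.
Arguments epath R {X p} t.
Arguments bd R X p : clear implicits.

(* Signs are booleans: false is +1, true is -1, addb is the product and negb  *)
(* is negation. The values of sgn off the arrows are irrelevant.              *)
Record sdigraph := SDigraph {
  vertex :> finType;
  arrow : rel vertex;
  sgn : vertex -> vertex -> bool;
  arrow_irr : irreflexive arrow
}.

Record smor (D D' : sdigraph) := SMor {
  smap : D -> D';
  seta : D -> bool;
  smap_arrow : forall i j, arrow i j -> smap i != smap j ->
    arrow (smap i) (smap j) /\
    sgn (smap i) (smap j) = seta i (+) sgn i j (+) seta j;
  smap_collapse : forall i j, arrow i j -> smap i = smap j ->
    sgn i j = seta i (+) seta j
}.

Lemma smor_eq (D D' : sdigraph) (m n : smor D D') :
  smap m = smap n -> seta m = seta n -> m = n.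
Proof.
case: m n => [f e a c] [g h b d] /= fg eh; subst g h.
by rewrite (Prop_irrelevance a b) (Prop_irrelevance c d).
Qed.

Section Identity.
Variable D : sdigraph.

Fact smor_id_arrow (i j : D) : arrow i j -> i != j ->
  arrow i j /\ sgn i j = false (+) sgn i j (+) false.
Proof. by rewrite addbF. Qed.

Fact smor_id_collapse (i j : D) : arrow i j -> i = j ->
  sgn i j = false (+) false.
Proof. by move=> ij eij; rewrite eij arrow_irr in ij. Qed.

Definition smor_id : smor D D :=
  @SMor D D id (fun=> false) smor_id_arrow smor_id_collapse.
End Identity.

Section Composition.
Variables (D D' D'' : sdigraph) (n : smor D' D'') (m : smor D D').

Let h := smap n \o smap m.
Let zeta i := seta n (smap m i) (+) seta m i.

Fact smor_comp_arrow (i j : D) : arrow i j -> h i != h j ->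
  arrow (h i) (h j) /\ sgn (h i) (h j) = zeta i (+) sgn i j (+) zeta j.
Proof.
move=> ij hij; have mij : smap m i != smap m j.
  by apply: contra_neq hij; rewrite /h /= => ->.
have [aij sij] := smap_arrow ij mij.
have [-> ->] := smap_arrow aij hij; split=> //.
by rewrite sij /zeta; case: (sgn i j); do !case: (seta _ _).
Qed.

Fact smor_comp_collapse (i j : D) : arrow i j -> h i = h j ->
  sgn i j = zeta i (+) zeta j.
Proof.
move=> ij hij; rewrite /zeta; have [mij | mij] := eqVneq (smap m i) (smap m j).
  by rewrite mij (smap_collapse ij mij); do !case: (seta _ _).
have [aij sij] := smap_arrow ij mij.
move: (smap_collapse aij hij); rewrite sij.
by case: (sgn i j); do !case: (seta _ _).
Qed.

Definition smor_comp : smor D D'' :=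
  @SMor D D'' h zeta smor_comp_arrow smor_comp_collapse.
End Composition.

Section SignedChains.
Variables (R : realType) (D : sdigraph).
Implicit Type p : nat.

Definition lifted : finType := (D * bool)%type.

Definition cover_arrow : rel lifted :=
  [rel x y | arrow x.1 y.1 && (y.2 == x.2 (+) sgn x.1 y.1)].

Definition deck (x : lifted) : lifted := (x.1, ~~ x.2).

Definition allowed n (t : n.-tuple lifted) : bool := sorted cover_arrow t.

Definition deck_rel p : {vspace chain R lifted p} :=
  <<[seq (epath R (map_tuple deck (val g)) + epath R (val g))%R
    | g : rpath lifted p]>>%VS.

Definition schain p : vectType R := vquot (deck_rel p).

Definition pclass p (t : p.+1.-tuple lifted) : schain p :=
  vclass (deck_rel p) (epath R t).

Lemma pclass_deck p (t : p.+1.-tuple lifted) :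
  pclass (map_tuple deck t) = - pclass t.
Proof.
have [tR | tN] := boolP (regular t); last first.
  rewrite /pclass !epath_nonregular ?linear0 ?oppr0 //.
  apply: contra tN; rewrite /regular /= sorted_map => tR.
  by apply: sub_sorted tR => x y /=; apply: contra_neq => ->.
apply/eqP; rewrite -addr_eq0 /pclass -linearD; apply/eqP.
rewrite -(linear0 (vclass _)); apply/vclass_eq; rewrite subr0.
by apply: memv_span; apply/mapP; exists (Sub t tR); rewrite ?mem_enum ?SubK.
Qed.

(* There is no schain in degree -1; since the boundary is 0 in degree 0, it   *)
(* may be given schain 0 = schain 0.-1 as a target.                           *)
Definition sbd p : 'Hom(schain p, schain p.-1) :=
  match p with
  | 0 => 0
  | p'.+1 => vlift (deck_rel p'.+1)
               (linfun (vclass (deck_rel p')) \o bd R lifted p')%VF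
  end.

Lemma sbd_class p x :
  sbd p.+1 (vclass (deck_rel p.+1) x) = vclass (deck_rel p) (bd R lifted p x).
Proof.
rewrite vlift_class ?comp_lfunE ?lfunE //; apply/span_subvP => _ /mapP[g _ ->].
rewrite memv_ker comp_lfunE lfunE /= linearD /= !bd_epath -big_split /=.
rewrite linear_sum /= big1 // => q _; rewrite -scalerDr linearZ /= linearD /=.
have -> : face (map_tuple deck (val g)) q = map_tuple deck (face (val g) q).
  by apply: eq_from_tnth => i; rewrite !(tnth_mktuple, tnth_map).
by rewrite -!/(pclass _) pclass_deck addNr scaler0.
Qed.

Lemma sbd_pclass p (t : p.+2.-tuple lifted) :
  sbd p.+1 (pclass t) = \sum_(q < p.+2) (-1) ^+ q *: pclass (face t q).
Proof.
rewrite sbd_class bd_epath linear_sum; apply: eq_bigr => q _.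
by rewrite linearZ.
Qed.

Lemma sbd_sbd p x : sbd p (sbd p.+1 x) = 0.
Proof.
case: p x => [|p] x; first by rewrite zero_lfunE.
rewrite -[x]vreprK !sbd_class -comp_lfunE bd_bd zero_lfunE.
by rewrite linear0.
Qed.

Definition allowed_space p : {vspace schain p} :=
  <<[seq pclass t | t in @allowed p.+1]>>%VS.

(* In degree 0 the second condition is trivial, because sbd 0 = 0. *)
Definition Omega p : {vspace schain p} :=
  (allowed_space p :&: sbd p @^-1: allowed_space p.-1)%VS.

Definition cycles p : {vspace schain p} := (Omega p :&: lker (sbd p))%VS.

Definition boundaries p : {vspace schain p} := (sbd p.+1 @: Omega p.+1)%VS.

Lemma boundaries_sub p : (boundaries p <= cycles p)%VS.
Proof.
apply/subvP => _ /memv_imgP[x + ->]; rewrite !memv_cap !memv_ker => /andP[_].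
rewrite -memv_preim => ->; rewrite -memv_preim sbd_sbd mem0v.
by rewrite eqxx.
Qed.

(* boundaries p as a subspace of the space of cycles *)
Definition cycle_boundaries p : {vspace subvs_of (cycles p)} :=
  (linfun vsval @^-1: boundaries p)%VS.

Definition homology p : vectType R := vquot (cycle_boundaries p).

(* The homology class of z, meaningful for z in cycles p. *)
Definition hclass p (z : schain p) : homology p :=
  vclass (cycle_boundaries p) (vsproj (cycles p) z).

End SignedChains.

Section InducedMap.
Variables (R : realType) (D D' : sdigraph) (m : smor D D').
Implicit Type p : nat.

Definition lift_map (x : lifted D) : lifted D' :=
  (smap m x.1, seta m x.1 (+) x.2).

Definition chain_map p : 'Hom(schain R D p, schain R D' p) :=
  vlift (deck_rel R D p)
    (lext (fun g : rpath (lifted D) p => pclass R (map_tuple lift_map (val g)))).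

Lemma chain_map_pclass p (t : p.+1.-tuple (lifted D)) :
  chain_map p (pclass R t) = pclass R (map_tuple lift_map t).
Proof.
pose f := lext (fun g : rpath (lifted D) p =>
  pclass R (map_tuple lift_map (val g))).
have fE u : f (epath R u) = pclass R (map_tuple lift_map u).
  have [uR | uN] := boolP (regular u).
    exact: (lext_epath (fun u => pclass R (map_tuple lift_map u))).
  rewrite epath_nonregular // linear0 /pclass epath_nonregular ?linear0 //.
  apply: contra uN; rewrite /regular /= sorted_map => uR.
  by apply: sub_sorted uR => x y /=; apply: contra_neq => ->.
rewrite /chain_map vlift_class ?fE //; apply/span_subvP => _ /mapP[g _ ->].
rewrite memv_ker linearD /= !fE.
set u := map_tuple lift_map (val g).
have -> : map_tuple lift_map (map_tuple (@deck D) (val g)) =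
          map_tuple (@deck D') u.
  apply: eq_from_tnth => i; rewrite !tnth_map /lift_map /deck /=.
  by rewrite addbN.
by rewrite pclass_deck addNr.
Qed.

End InducedMap.

Record category := Category {
  object :> Type;
  hom : object -> object -> Type;
  idm : forall a, hom a a;
  compm : forall a b c, hom b c -> hom a b -> hom a c;
  comp1m : forall a b (f : hom a b), compm (idm b) f = f;
  compm1 : forall a b (f : hom a b), compm f (idm a) = f;
  compmA : forall a b c d (h : hom c d) (g : hom b c) (f : hom a b),
    compm h (compm g f) = compm (compm h g) f
}.

Definition is_functor (C C' : category) (Fo : C -> C')
    (Fm : forall a b : C, hom a b -> hom (Fo a) (Fo b)) : Prop :=
  (forall a, Fm a a (idm a) = idm (Fo a)) /\
  (forall (a b c : C) (g : hom b c) (f : hom a b),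
     Fm a c (compm g f) = compm (Fm b c g) (Fm a b f)).

Section SignedDigraphCategory.
Implicit Types D : sdigraph.

Fact smor_comp1m D D' (m : smor D D') : smor_comp (smor_id D') m = m.
Proof. by apply: smor_eq; apply/funext. Qed.

Fact smor_compm1 D D' (m : smor D D') : smor_comp m (smor_id D) = m.
Proof. by apply: smor_eq; apply/funext => // i /=; rewrite addbF. Qed.

Fact smor_compA D1 D2 D3 D4
    (h : smor D3 D4) (g : smor D2 D3) (f : smor D1 D2) :
  smor_comp h (smor_comp g f) = smor_comp (smor_comp h g) f.
Proof. by apply: smor_eq; apply/funext => // i /=; rewrite addbA. Qed.

Definition SDigraphCat : category :=
  Category smor_comp1m smor_compm1 smor_compA.
End SignedDigraphCategory.

Section VectorSpaceCategory.
Variable R : realType.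
Implicit Types U V W : lmodType R.

Lemma linear_eq U V (f g : {linear U -> V}) : f =1 g -> f = g.
Proof.
case: f g => [f cf] [g cg] /= /funext fg; subst g; congr GRing.Linear.Pack.
case: cf cg => [[a] [b]] [[c] [d]].
by rewrite (Prop_irrelevance a c) (Prop_irrelevance b d).
Qed.

Definition linear_id U : {linear U -> U} := idfun.
Definition linear_comp U V W (g : {linear V -> W}) (f : {linear U -> V}) :
  {linear U -> W} := g \o f.

Fact linear_comp1m U V (f : {linear U -> V}) : linear_comp (linear_id V) f = f.
Proof. exact: linear_eq. Qed.

Fact linear_compm1 U V (f : {linear U -> V}) : linear_comp f (linear_id U) = f.
Proof. exact: linear_eq. Qed.

Fact linear_compA U V W W' (h : {linear W -> W'}) (g : {linear V -> W})
    (f : {linear U -> V}) :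
  linear_comp h (linear_comp g f) = linear_comp (linear_comp h g) f.
Proof. exact: linear_eq. Qed.

Definition VectorSpaceCat : category :=
  Category linear_comp1m linear_compm1 linear_compA.
End VectorSpaceCategory.

(* Main.v *)
(* The lift of a signed weak morphism sends an arrow of the double cover to an
   arrow or, when its endpoints are identified, to a repeated lifted vertex:
   condition (ii) forces the two signs to agree. So an allowed path is sent to
   an allowed path or to a nonregular one, whose class is 0, and commutation
   with the boundary holds already on all regular paths. *)
Require Import Defs.
From HB Require Import structures.
From mathcomp Require Import all_boot all_order all_algebra.
From mathcomp Require Import boolp reals.

Set Implicit Arguments.
Unset Strict Implicit.
Unset Printing Implicit Defensive.

Import GRing.Theory Num.Theory.
Local Open Scope ring_scope.

Section InducedChainMap.
Variable R : realType.
Implicit Types D : sdigraph.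

(** Expanding a representative chain in the regular paths shows that path classes span [schain]. *)
Lemma schain_sum D p (z : schain R D p) :
  exists a : rpath (lifted D) p -> R, z = \sum_g a g *: pclass R (val g).
Proof.
exists (vrepr z); rewrite -[LHS]vreprK [in LHS](chain_sum (vrepr z)) linear_sum.
by apply: eq_bigr => g _; rewrite linearZ.
Qed.

Lemma pclass_linear_eq D p (wT : vectType R) (f g : 'Hom(schain R D p, wT)) :
  (forall t, f (pclass R t) = g (pclass R t)) -> f =1 g.
Proof.
move=> fg z; have [a ->] := schain_sum z; rewrite !linear_sum.
by apply: eq_bigr => h _; rewrite !linearZ /= fg.
Qed.

Lemma face_map (X Y : finType) (f : X -> Y) p (t : p.+2.-tuple X) q :
  face (map_tuple f t) q = map_tuple f (face t q).
Proof. by apply: eq_from_tnth => i; rewrite !(tnth_mktuple, tnth_map). Qed.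

(** Deleting a vertex commutes with a vertexwise map. The formulas for [sbd] and [chain_map] on
    [pclass] hold for nonregular tuples too, so degenerate images need no separate case. *)
Lemma sbd_chain_map D D' (m : smor D D') p z :
  sbd R D' p (chain_map R m p z) = chain_map R m p.-1 (sbd R D p z).
Proof.
case: p z => [|p] z; first by rewrite !zero_lfunE linear0.
rewrite -!comp_lfunE; move: z; apply: pclass_linear_eq => t.
rewrite !comp_lfunE chain_map_pclass !sbd_pclass linear_sum.
apply: eq_bigr => q _.
by rewrite face_map linearZ /= chain_map_pclass.
Qed.

Lemma lift_map_arrow D D' (m : smor D D') (x y : lifted D) :
  cover_arrow x y -> lift_map m x != lift_map m y ->
  cover_arrow (lift_map m x) (lift_map m y).
Proof.
case: x y => [i e] [j d] /andP[/= ij /eqP->]; rewrite /lift_map /=.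
have [fij | fij _] := eqVneq (smap m i) (smap m j).
  (* By [smap_collapse] the lifted signs agree as well, so the two images coincide, against the
     hypothesis. *)
  rewrite fij (smap_collapse ij fij) => /eqP[]; congr (_, _).
  by case: e; do !case: (seta _ _).
have [aij sij] := smap_arrow ij fij.
rewrite /cover_arrow /= aij sij /=.
by case: e; case: (sgn i j); do !case: (seta _ _).
Qed.

(** Regularity of the image keeps consecutive images distinct, so [lift_map_arrow] applies to each
    step. *)
Lemma allowed_lift_map D D' (m : smor D D') n (t : n.-tuple (lifted D)) :
  allowed t -> regular (map_tuple (lift_map m) t) ->
  allowed (map_tuple (lift_map m) t).
Proof.
rewrite /allowed /regular /= !sorted_map; case: (tval t) => //= x s.
elim: s x => //= y s IHs x /andP[xy ys] /andP[mxy mys].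
by rewrite /relpre /= IHs // andbT lift_map_arrow.
Qed.

Lemma chain_map_allowed D D' (m : smor D D') p z :
  z \in allowed_space R D p -> chain_map R m p z \in allowed_space R D' p.
Proof.
move=> zA; rewrite memv_preim; apply: subvP z zA.
apply/span_subvP => _ /imageP[t tA ->].
rewrite -memv_preim chain_map_pclass.
have [tR | tN] := boolP (regular (map_tuple (lift_map m) t)); last first.
  by rewrite /pclass epath_nonregular // linear0 mem0v.
by apply/memv_span/image_f/allowed_lift_map.
Qed.

(** Commutation turns the boundary condition on the image into [chain_map_allowed] one degree
    lower. *)
Lemma chain_map_Omega D D' (m : smor D D') p z :
  z \in Omega R D p -> chain_map R m p z \in Omega R D' p.
Proof.
rewrite !memv_cap -!memv_preim sbd_chain_map => /andP[zA dzA].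
by rewrite !chain_map_allowed.
Qed.

Lemma chain_map_cycles D D' (m : smor D D') p z :
  z \in cycles R D p -> chain_map R m p z \in cycles R D' p.
Proof.
(* The pattern splits only the intersection defining [cycles]; [Omega], itself an intersection,
   stays folded. *)
rewrite !(memv_cap _ (Omega _ _ _)) !memv_ker sbd_chain_map.
by move=> /andP[/chain_map_Omega -> /eqP->]; rewrite linear0 eqxx.
Qed.

Lemma chain_map_boundaries D D' (m : smor D D') p z :
  z \in boundaries R D p -> chain_map R m p z \in boundaries R D' p.
Proof.
case/memv_imgP=> x xO ->; rewrite -(sbd_chain_map m (p := p.+1)).
exact/memv_img/chain_map_Omega.
Qed.

Lemma chain_map_id D p : chain_map R (smor_id D) p =1 id.
Proof.
move=> z; rewrite -[RHS]id_lfunE; move: z; apply: pclass_linear_eq => t.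
rewrite id_lfunE chain_map_pclass; congr (pclass R _).
by apply: eq_from_tnth => i; rewrite tnth_map; case: (tnth t i).
Qed.

Lemma chain_map_comp D D' D'' (n : smor D' D'') (m : smor D D') p :
  chain_map R (smor_comp n m) p =1 chain_map R n p \o chain_map R m p.
Proof.
move=> z /=; rewrite -comp_lfunE; move: z; apply: pclass_linear_eq => t.
rewrite comp_lfunE !chain_map_pclass; congr (pclass R _).
by apply: eq_from_tnth => i; rewrite !tnth_map /lift_map /= addbA.
Qed.

Lemma hclass_surj D p (q : homology R D p) :
  exists2 z, z \in cycles R D p & q = hclass z.
Proof.
exists (vsval (vrepr q)); first exact: subvsP.
by rewrite /hclass vsvalK vreprK.
Qed.

Lemma hclass_boundary D p z : z \in boundaries R D p -> hclass z = 0.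
Proof.
move=> zB; rewrite /hclass -(linear0 (vclass _)); apply/vclass_eq.
(* [vsprojK] requires [z] to be a cycle, which [boundaries_sub] supplies. *)
rewrite subr0 -memv_preim lfunE /= vsprojK //.
exact: subvP (boundaries_sub R D p) _ zB.
Qed.

(** [vsproj] is linear on the whole chain space, so [hclass] can be a factor of the composite in
    [homology_map]. *)
Lemma hclass_is_linear D p : linear (@hclass R D p).
Proof. by move=> a x y; rewrite /hclass !linearP. Qed.

HB.instance Definition _ D p := GRing.isLinear.Build R (schain R D p)
  (homology R D p) _ (@hclass R D p) (@hclass_is_linear D p).

Definition homology_map p D D' (m : smor D D') :
    {linear homology R D p -> homology R D' p} :=
  vlift (cycle_boundaries R D p)
    (linfun (@hclass R D' p) \o chain_map R m p \o linfun vsval)%VF.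

Lemma homology_map_hclass p D D' (m : smor D D') z :
  z \in cycles R D p ->
  homology_map p m (hclass z) = hclass (chain_map R m p z).
Proof.
move=> zC; rewrite /homology_map /= vlift_class.
  by rewrite !comp_lfunE lfunE [linfun vsval _]lfunE /= vsprojK.
(* The condition for [vlift] to be the induced map: the composite kills boundaries. *)
apply/subvP => x; rewrite -memv_preim memv_ker !comp_lfunE 2!lfunE /= => xB.
by rewrite hclass_boundary ?chain_map_boundaries.
Qed.

Lemma homology_map_id p D : homology_map p (smor_id D) =1 id.
Proof.
move=> q; have [z zC ->] := hclass_surj q.
by rewrite homology_map_hclass // chain_map_id.
Qed.

Lemma homology_map_comp p D D' D'' (n : smor D' D'') (m : smor D D') :
  homology_map p (smor_comp n m) =1 homology_map p n \o homology_map p m.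
Proof.
move=> q; have [z zC ->] := hclass_surj q.
by rewrite /= !homology_map_hclass ?chain_map_cycles // chain_map_comp.
Qed.

End InducedChainMap.

Theorem theorem5p6 (R : realType) :
  (forall (D D' : sdigraph) (m : smor D D') (p : nat) (z : schain R D p),
     z \in Omega R D p ->
     chain_map R m p z \in Omega R D' p /\
     sbd R D' p (chain_map R m p z) = chain_map R m p.-1 (sbd R D p z)) /\
  exists Hmap : forall (p : nat) (D D' : sdigraph), smor D D' ->
      {linear homology R D p -> homology R D' p},
    [/\ forall (p : nat) (D D' : sdigraph) (m : smor D D') (z : schain R D p),
          z \in cycles R D p ->
          Hmap p D D' m (hclass z) = hclass (chain_map R m p z),
        forall (p : nat) (D : sdigraph),
          Hmap p D D (smor_id D) =1 id,
        forall (p : nat) (D D' D'' : sdigraph) (n : smor D' D'') (m : smor D D'),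
          Hmap p D D'' (smor_comp n m) =1 Hmap p D' D'' n \o Hmap p D D' m
      & forall p : nat,
          is_functor (C := SDigraphCat) (C' := VectorSpaceCat R)
            (Fo := fun D : sdigraph => homology R D p) (Hmap p)].
Proof.
split=> [D D' m p z zO|].
  by split; [exact: chain_map_Omega | exact: sbd_chain_map].
exists (homology_map R); split.
- by move=> p D D' m z; apply: homology_map_hclass.
- exact: homology_map_id.
- exact: homology_map_comp.
(* Morphisms of [VectorSpaceCat] are bundled linear maps; [linear_eq] reduces their equality to the
   pointwise laws. *)
move=> p; split=> [D | D D' D'' n m]; apply: linear_eq.
  exact: homology_map_id.
exact: homology_map_comp.
Qed.
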